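(* Let $A$ be a Banach algebra. Then the following assertions are equivalent. (a) $A$ is weakly amenable. (b) $A$ is both cyclically amenable and cyclically weakly amenable. In this case, $A$ is point amenable and essential.
   Context: Let $A$ be a complex Banach algebra with dual $A^*$. For $F\in A^*$ and $a,b\in A$ put $\langle F\cdot a,b\rangle=\langle F,ab\rangle$ and $\langle a\cdot F,b\rangle=\langle F,ba\rangle$. A linear operator $D:A\to A^*$ is a derivation if $D(ab)=D(a)\cdot b+a\cdot D(b)$ for all $a,b\in A$. It is inner if there is $F\in A^*$ with $D(a)=F\cdot a-a\cdot F$ for all $a\in A$. It is cyclic if $\langle D(a),b\rangle+\langle D(b),a\rangle=0$ for all $a,b\in A$. Let $\mathcal{Z}(A,A^* )$, $\mathcal{I}_{nn}(A,A^* )$, $\mathcal{Z}_C(A,A^* )$ denote the spaces of all continuous derivations, continuous inner derivations, and continuous cyclic derivations from $A$ into $A^*$, respectively. $A$ is weakly amenable if $\mathcal{Z}(A,A^* )=\mathcal{I}_{nn}(A,A^* )$; cyclically amenable if $\mathcal{Z}_C(A,A^* )=\mathcal{I}_{nn}(A,A^* )$; cyclically weakly amenable if $\mathcal{Z}(A,A^* )=\mathcal{Z}_C(A,A^* )$. $\Delta(A)$ is the set of all non-zero multiplicative linear functionals on $A$. A functional $d\in A^*$ is a continuous point derivation of $A$ at $\varphi\in\Delta(A)$ if $d(ab)=d(a)\varphi(b)+\varphi(a)d(b)$ for all $a,b\in A$. $A$ is point amenable if, for every $\varphi\in\Delta(A)$, every continuous point derivation of $A$ at $\varphi$ is zero.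 $A$ is essential if $A^2$ (the linear span of all products $ab$, $a,b\in A$) is dense in $A$. *)

(* Defs.v *)
From HB Require Import structures.
From mathcomp Require Import all_boot all_order all_algebra.
From mathcomp Require Import complex.
From mathcomp Require Import boolp classical_sets functions filter.
From mathcomp Require Import reals topology normedtype.

Set Implicit Arguments.
Unset Strict Implicit.
Unset Printing Implicit Defensive.

Import Order.TTheory GRing.Theory Num.Theory.
Import numFieldNormedType.Exports.

Local Open Scope classical_set_scope.
Local Open Scope ring_scope.
Local Open Scope complex_scope.

(* Not assumed unital: MathComp rings always have a unit, so the product is a
   new operation rather than the ring multiplication. *)
HB.mixin Record CompleteNormedModule_isBanachAlgebra (K : numFieldType) A
    & CompleteNormedModule K A := {
  bmul : A -> A -> A;
  bmulA : associative bmul;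
  bmulDl : left_distributive bmul +%R;
  bmulDr : right_distributive bmul +%R;
  bmulZl : forall (k : K) (a b : A), bmul (k *: a) b = k *: bmul a b;
  bmulZr : forall (k : K) (a b : A), bmul a (k *: b) = k *: bmul a b;
  ler_norm_bmul : forall a b : A, `|bmul a b| <= `|a| * `|b|
}.

#[short(type="banachAlgType")]
HB.structure Definition BanachAlgebra (K : numFieldType) :=
  {A of CompleteNormedModule K A & CompleteNormedModule_isBanachAlgebra K A}.

Reserved Notation "a ** b" (at level 40, left associativity).
Notation "a ** b" := (bmul a b) : ring_scope.


(* Continuous linear functionals on V; R[i]^o is R[i] as a normed module over
   itself. *)
Section Dual.
Variables (R : realType) (V : normedModType R[i]).

Definition dual_pred : {pred V -> R[i]^o} :=
  fun f => `[< linear f /\ continuous f >].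

Record dual := Dual { dual_fun :> V -> R[i]^o; dualP : dual_fun \in dual_pred }.

HB.instance Definition _ := [isSub for dual_fun].
HB.instance Definition _ := [Choice of dual by <:].

Lemma dual_submod_closed : submod_closed dual_pred.
Proof.
split=> [|k f g /asboolP[lf cf] /asboolP[lg cg]]; apply/asboolP; split.
- by move=> c x y; rewrite /GRing.zero/= scaler0 addr0.
- by move=> x; exact: cvg_cst.
- move=> c x y; rewrite -[LHS]/(k *: f (c *: x + y) + g (c *: x + y)) lf lg.
  by rewrite !scalerDr !scalerA mulrC -scalerA addrACA -scalerDr.
- move=> x; apply: continuousD; last exact: cg.
  by apply: continuousZl_tmp; exact: cf.
Qed.

HB.instance Definition _ :=
  GRing.isSubmodClosed.Build R[i] (V -> R[i]^o) dual_pred dual_submod_closed.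
HB.instance Definition _ := [SubChoice_isSubLmodule of dual by <:].

Lemma dual_linear (f : dual) : linear f.
Proof. by have /asboolP[] := dualP f. Qed.

Lemma dual_continuous (f : dual) : continuous f.
Proof. by have /asboolP[] := dualP f. Qed.

HB.instance Definition _ (f : dual) :=
  GRing.isLinear.Build R[i] V R[i]^o *:%R (dual_fun f) (dual_linear f).

(* The operator norm: norms over R[i] are R[i]-valued, whence the detour
   through the real part to take a supremum. *)
Definition dual_norm (f : dual) : R[i] :=
  (sup [set complex.Re `|f x| | x in [set x : V | `|x| <= 1]])%:C.

Let ReK (z : R[i]) : (complex.Re `|z|)%:C = `|z|.
Proof. by rewrite RRe_real// normr_real. Qed.

Let le_Re (z : R[i]) (y : R) : (complex.Re `|z| <= y) = (`|z| <= y%:C).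
Proof. by rewrite -[in RHS](ReK z) lecR. Qed.

Lemma dual_norm_ub (f : dual) (x : V) : `|x| <= 1 -> `|f x| <= dual_norm f.
Proof.
move=> x1; rewrite /dual_norm -le_Re; apply: ub_le_sup; last by exists x.
have /linear_boundedP/pinfty_ex_gt0[M M0 fM] :
  bounded_near f (nbhs (0 : V)).
  by apply/linear_bounded_continuous; exact: dual_continuous.
exists (complex.Re M) => _ [y /= y1 <-]; rewrite le_Re RRe_real ?gtr0_real//.
by rewrite (le_trans (fM y))// ler_piMr// ltW.
Qed.

Lemma dual_norm_le (f : dual) (M : R[i]) :
  (forall x, `|x| <= 1 -> `|f x| <= M) -> dual_norm f <= M.
Proof.
move=> fM.
have M0 : 0 <= M by rewrite (le_trans _ (fM 0 _)) ?normr0.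
rewrite /dual_norm -[M]RRe_real ?ger0_real// lecR; apply: ge_sup.
  by exists (complex.Re `|f 0|); exists 0 => //=; rewrite normr0.
by move=> _ [x /= x1 <-]; rewrite le_Re RRe_real ?ger0_real//; exact: fM.
Qed.

Lemma dual_normD (f g : dual) : dual_norm (f + g) <= dual_norm f + dual_norm g.
Proof.
apply: dual_norm_le => x x1.
by rewrite (le_trans (ler_normD _ _))// lerD// dual_norm_ub.
Qed.

Let dual_normZ_le (k : R[i]) (f : dual) :
  dual_norm (k *: f) <= `|k| * dual_norm f.
Proof.
apply: dual_norm_le => x x1.
by rewrite [leLHS]normrM ler_wpM2l// dual_norm_ub.
Qed.

Lemma dual_normZ (k : R[i]) (f : dual) :
  dual_norm (k *: f) = `|k| * dual_norm f.
Proof.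
apply/le_anti; rewrite dual_normZ_le/=.
have [->|k0] := eqVneq k 0.
  by rewrite normr0 mul0r (le_trans _ (dual_norm_ub _ (x := 0) _)) ?normr0.
rewrite -ler_pdivlMl ?normr_gt0// -normfV.
by rewrite -[in leLHS](scalerK k0 f) dual_normZ_le.
Qed.

Lemma dual_norm0_eq0 (f : dual) : dual_norm f = 0 -> f = 0.
Proof.
move=> f0; apply/val_inj/funext => x /=.
have [->|x0] := eqVneq x 0; first by rewrite linear0.
have : `|f (`|x|^-1 *: x)| <= 0.
  rewrite -f0 dual_norm_ub// normrZ normfV normr_id mulVf//.
  by rewrite normr_eq0.
rewrite linearZ/= normr_le0 scaler_eq0 invr_eq0 normr_eq0 (negPf x0)/=.
by move/eqP.
Qed.

HB.instance Definition _ :=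
  Lmodule_isNormed.Build R[i] dual dual_normD dual_normZ dual_norm0_eq0.

Lemma dual_normE (f : dual) : `|f| = dual_norm f.
Proof. by []. Qed.

End Dual.

Section BanachAlgebraTheory.
Variables (R : realType) (A : banachAlgType R[i]).
Implicit Types (a b : A) (F : dual A).

Lemma bmull_continuous a : continuous (fun b => a ** b).
Proof.
pose f : A -> A := fun b => a ** b.
have lf : linear f by move=> k x y; rewrite /f bmulDr bmulZr.
pose g : {linear A -> A} := HB.pack f (GRing.isLinear.Build _ _ _ _ _ lf).
apply: (@bounded_linear_continuous _ _ _ g); apply/linear_boundedP.
near=> r => x; rewrite (le_trans (ler_norm_bmul _ _))// ler_wpM2r//.
by near: r; apply: nbhs_pinfty_ge; rewrite normr_real.
Unshelve. all: by end_near. Qed.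

Lemma bmulr_continuous a : continuous (fun b => b ** a).
Proof.
pose f : A -> A := fun b => b ** a.
have lf : linear f by move=> k x y; rewrite /f bmulDl bmulZl.
pose g : {linear A -> A} := HB.pack f (GRing.isLinear.Build _ _ _ _ _ lf).
apply: (@bounded_linear_continuous _ _ _ g); apply/linear_boundedP.
near=> r => x; rewrite (le_trans (ler_norm_bmul _ _))// mulrC ler_wpM2r//.
by near: r; apply: nbhs_pinfty_ge; rewrite normr_real.
Unshelve. all: by end_near. Qed.

Lemma dual_ract_subproof F a : (fun b => F (a ** b)) \in @dual_pred R A.
Proof.
apply/asboolP; split=> [k x y|x]; first by rewrite bmulDr bmulZr linearP.
by apply: (@continuous_comp _ _ _ (fun b => a ** b) F);
  [exact: bmull_continuous|exact: dual_continuous].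
Qed.

Lemma dual_lact_subproof a F : (fun b => F (b ** a)) \in @dual_pred R A.
Proof.
apply/asboolP; split=> [k x y|x]; first by rewrite bmulDl bmulZl linearP.
by apply: (@continuous_comp _ _ _ (fun b => b ** a) F);
  [exact: bmulr_continuous|exact: dual_continuous].
Qed.

(* <F . a, b> = <F, ab> and <a . F, b> = <F, ba> *)
Definition dual_ract F a : dual A := Dual (dual_ract_subproof F a).
Definition dual_lact a F : dual A := Dual (dual_lact_subproof a F).

End BanachAlgebraTheory.

Section Amenability.
Variables (R : realType) (A : banachAlgType R[i]).
Implicit Types D : A -> dual A.

Definition derivation D :=
  linear D /\
  forall a b : A, D (a ** b) = dual_ract (D a) b + dual_lact a (D b).

Definition inner D :=
  exists F : dual A, forall a : A, D a = dual_ract F a - dual_lact a F.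

Definition cyclic D := forall a b : A, D a b + D b a = 0.

Definition cont_derivations : set (A -> dual A) :=
  [set D | derivation D /\ continuous D].

Definition cont_inner_derivations : set (A -> dual A) :=
  [set D | [/\ derivation D, continuous D & inner D]].

Definition cont_cyclic_derivations : set (A -> dual A) :=
  [set D | [/\ derivation D, continuous D & cyclic D]].

Definition weakly_amenable := cont_derivations = cont_inner_derivations.

Definition cyclically_amenable :=
  cont_cyclic_derivations = cont_inner_derivations.

Definition cyclically_weakly_amenable :=
  cont_derivations = cont_cyclic_derivations.

(* Non-zero multiplicative linear functionals, with no continuity assumed. *)
Definition characters : set (A -> R[i]^o) :=
  [set phi | [/\ linear phi, forall a b, phi (a ** b) = phi a * phi b
               & exists a, phi a != 0]].

Definition point_derivation (phi : A -> R[i]^o) (d : dual A) :=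
  forall a b : A, d (a ** b) = d a * phi b + phi a * d b.

Definition point_amenable :=
  forall phi, characters phi ->
  forall d : dual A, point_derivation phi d -> d = 0.

Definition square_span : set A :=
  [set x | exists n (k : 'I_n -> R[i]) (a b : 'I_n -> A),
             x = \sum_(i < n) k i *: (a i ** b i)].

Definition essential := dense square_span.

End Amenability.

Arguments weakly_amenable {R} A.
Arguments cyclically_amenable {R} A.
Arguments cyclically_weakly_amenable {R} A.
Arguments point_amenable {R} A.
Arguments essential {R} A.

(* Main.v *)
From HB Require Import structures.
Require Import Defs.
From mathcomp Require Import all_boot all_order all_algebra.
From mathcomp Require Import complex.
From mathcomp Require Import boolp classical_sets.
From mathcomp Require Import reals topology normedtype.
From mathcomp Require Import ring lra.

Set Implicit Arguments.
Unset Strict Implicit.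
Unset Printing Implicit Defensive.

Import Order.TTheory GRing.Theory Num.Theory.
Import numFieldNormedType.Exports.

Local Open Scope classical_set_scope.
Local Open Scope ring_scope.
Local Open Scope complex_scope.

(** Inner derivations are cyclic, because F(ab) - F(ba) is antisymmetric in
    (a, b).  Hence inner, cyclic and arbitrary continuous derivations always
    form an increasing chain of three spaces: weak amenability says that the
    two ends coincide, and the two conditions of (b) say that each of the two
    inclusions is an equality.

    Both remaining claims come from one observation on rank one operators
    a |-> d(a) F, with d and F in the dual.  If such an operator is a
    derivation and A is weakly amenable, it is inner, hence cyclic, i.e.
    d(a) F(b) = - d(b) F(a); taking b with F(b) <> 0 and then a = b gives
    d(b) = 0, and so d = 0.  Thus a weakly amenable algebra has no non-zero
    derivation of rank one ([weakly_amenable_rank_one]).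

    - If d is a point derivation at a character phi, then a |-> d(a) phi is a
      derivation, so d = 0.  For this phi must be continuous; when d(a) <> 0
      it is, since the Leibniz rule solves for
      phi(b) = (d(ab) - phi(a) d(b)) / d(a).
    - If F vanishes on all products, then a |-> F(a) F is a derivation, so
      F = 0.  By the Hahn-Banach theorem the span of the products is dense.

    The Hahn-Banach theorem is obtained by looking at sublinear functionals
    defined on the whole space instead of linear functionals on subspaces: the
    linear functionals are the minimal sublinear ones, and minimal ones exist
    by Zorn's lemma.  Lowering a sublinear functional along a convex cone of
    pairs (x, l), each one standing for the constraint l <= f(x), serves both
    to prove that minimal functionals are linear and to impose on the
    resulting functional the constraints in the cone ([mazur_orlicz]).  *)

(** * Linear functionals below a sublinear functional *)

Section MazurOrlicz.
Variables (R : realType) (V : lmodType R).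
Implicit Types (p : V -> R) (C : set (V * R)).

Definition sublinear p :=
  (forall x y, p (x + y) <= p x + p y) /\
  (forall t x, 0 < t -> p (t *: x) <= t * p x).

(** A pair (x, l) of the cone is to be read as the constraint l <= f x on an
    unknown linear functional f; the constraints satisfied by f do form a
    convex cone. *)
Definition convex_cone C :=
  [/\ C (0, 0), forall u v, C u -> C v -> C (u.1 + v.1, u.2 + v.2) &
      forall t u, 0 < t -> C u -> C (t *: u.1, t * u.2)].

Lemma sublinear0 p : sublinear p -> p 0 = 0.
Proof.
move=> [pD pZ]; apply/le_anti/andP; split.
  by have := pZ 2^-1 0; rewrite scaler0 invr_gt0 ltr0n => /(_ isT); lra.
by have := pD 0 0; rewrite addr0; lra.
Qed.

Lemma sublinear_oppr_ge p x : sublinear p -> - p (- x) <= p x.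
Proof. by move=> sp; have := sp.1 x (- x); rewrite subrr sublinear0//; lra. Qed.

Section LowerByCone.
Variables (p : V -> R) (C : set (V * R)).
Hypotheses (subp : sublinear p) (coneC : convex_cone C).
Hypothesis (C_le : forall u, C u -> u.2 <= p u.1).

(** If f is linear, below p and satisfies the constraints u in C, then
    f x = f (x + u.1) - f u.1 <= p (x + u.1) - u.2.  This is the best upper
    bound that can be derived in this way. *)
Definition cone_lowering x := inf [set p (x + u.1) - u.2 | u in C].

Let lowering_le x u : C u -> cone_lowering x <= p (x + u.1) - u.2.
Proof.
move=> Cu; apply: ge_inf; last by exists u.
exists (- p (- x)) => _ [v Cv <-].
by have := subp.1 (x + v.1) (- x); rewrite addrC addKr; have := C_le Cv; lra.
Qed.

Let lowering_ge x z :
  (forall u, C u -> z <= p (x + u.1) - u.2) -> z <= cone_lowering x.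
Proof.
have [C0 _ _] := coneC; move=> zC; apply: lb_le_inf.
  by exists (p (x + 0) - 0), (0, 0).
by move=> _ [u Cu <-]; exact: zC.
Qed.

Lemma cone_lowering_le x : cone_lowering x <= p x.
Proof.
by have [C0 _ _] := coneC; have := lowering_le x C0; rewrite addr0 subr0.
Qed.

(** Upper bounds on f (- x) are lower bounds on f x: this is how the cone
    constrains every linear functional below its lowering. *)
Lemma cone_lowering_opp u : C u -> cone_lowering (- u.1) <= - u.2.
Proof.
by move=> Cu; have := lowering_le (- u.1) Cu; rewrite addNr sublinear0// sub0r.
Qed.

Lemma cone_lowering_sublinear : sublinear cone_lowering.
Proof.
have [_ CD CZ] := coneC; split=> [x y|t x t0].
  rewrite -lerBlDr; apply: lowering_ge => u Cu.
  rewrite lerBlDr -lerBlDl; apply: lowering_ge => v Cv.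
  have := lowering_le (x + y) (CD _ _ Cu Cv).
  by have := subp.1 (x + u.1) (y + v.1); rewrite addrACA /=; lra.
rewrite -ler_pdivrMl//; apply: lowering_ge => u Cu.
rewrite ler_pdivrMl//; have := lowering_le (t *: x) (CZ _ _ t0 Cu).
by rewrite -scalerDr /=; have := subp.2 t (x + u.1) t0; lra.
Qed.

End LowerByCone.

Definition minimal_sublinear (q : V -> R) :=
  sublinear q /\
  forall r, sublinear r -> (forall x, r x <= q x) -> r = q.

(** Zorn's lemma for the reversed pointwise order.  The infimum of a chain is
    sublinear because, given two members of the chain, subadditivity can be
    applied to the smaller one; it is finite because every sublinear q <= p
    satisfies q x >= - q (- x) >= - p (- x). *)
Lemma ex_minimal_sublinear p : sublinear p ->
  exists2 q, minimal_sublinear q & forall x, q x <= p x.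
Proof.
move=> subp; pose T := {q | sublinear q /\ forall x, q x <= p x}.
pose below (q r : T) := `[< forall x, sval r x <= sval q x >].
have chain_inf (F : set T) : total_on F below ->
    exists m : T, forall q : T, F q -> below q m.
  move=> totF; have [->|/set0P[q0 Fq0]] := eqVneq F set0.
    by exists (exist _ p (conj subp (fun=> lexx _))).
  pose m x := inf [set sval q x | q in F].
  have m_le x q : F q -> m x <= sval q x.
    move=> Fq; apply: ge_inf; last by exists q.
    exists (- p (- x)) => _ [[r [subr rp]] _ <-] /=.
    by have := sublinear_oppr_ge x subr; have := rp (- x); lra.
  have m_ge x z : (forall q, F q -> z <= sval q x) -> z <= m x.
    move=> zF; apply: lb_le_inf; first by exists (sval q0 x), q0.
    by move=> _ [q Fq <-]; exact: zF.
  have subm : sublinear m.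
    split=> [x y|t x t0].
      rewrite -lerBlDr; apply: (m_ge) => q Fq; rewrite lerBlDr -lerBlDl.
      apply: (m_ge) => r Fr; rewrite lerBlDl.
      have [/asboolP qr|/asboolP rq] := totF _ _ Fq Fr.
        have := (svalP r).1.1 x y; have := m_le (x + y) _ Fr; have := qr x; lra.
      have := (svalP q).1.1 x y; have := m_le (x + y) _ Fq; have := rq y; lra.
    rewrite -ler_pdivrMl//; apply: (m_ge) => q Fq; rewrite ler_pdivrMl//.
    exact: le_trans (m_le _ _ Fq) ((svalP q).1.2 _ _ t0).
  have mp x : m x <= p x := le_trans (m_le x _ Fq0) ((svalP q0).2 x).
  by exists (exist _ m (conj subm mp)) => q Fq; apply/asboolP => x; exact: m_le.
have [||| [q [subq qp]] qmin] := Zorn _ _ _ chain_inf.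
- by move=> q; apply/asboolP.
- move=> q r s /asboolP qr /asboolP rs; apply/asboolP => x.
  exact: le_trans (rs x) (qr x).
- move=> [q Pq] [r Pr] /asboolP qr /asboolP rq; apply: eq_exist.
  by apply/funext => x; apply/le_anti; rewrite qr rq.
exists q => //; split=> // r subr rq.
have rp x : r x <= p x := le_trans (rq x) (qp x).
have /qmin : below (exist _ q (conj subq qp)) (exist _ r (conj subr rp)).
  exact/asboolP.
by case.
Qed.

(** Lowering q along the ray through (y, q y) yields a sublinear functional
    whose value at - y is at most - q y.  By minimality that functional is q,
    so q is odd, and an odd sublinear functional is linear. *)
Lemma minimal_sublinear_linear (q : V -> R) : minimal_sublinear q -> scalar q.
Proof.
move=> [subq qmin].
have qN y : q (- y) = - q y.
  pose C := [set u : V * R | exists2 t, 0 <= t & u = (t *: y, t * q y)].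
  have coneC : convex_cone C.
    split=> [|_ _ [s s0 ->] [t t0 ->]|s _ s0 [t t0 ->]] /=.
    - by exists 0 => //; rewrite scale0r mul0r.
    - by exists (s + t); rewrite ?addr_ge0// scalerDl mulrDl.
    - by exists (s * t); rewrite ?mulr_ge0 ?(ltW s0)// scalerA mulrA.
  have C_le u : C u -> u.2 <= q u.1.
    move=> [t]; rewrite le_eqVlt => /orP[/eqP <-|t0] ->/=.
      by rewrite scale0r mul0r sublinear0.
    have := subq.2 t^-1 (t *: y); rewrite invr_gt0 => /(_ t0).
    by rewrite scalerA mulVf ?gt_eqF// scale1r ler_pdivlMl.
  have eq_q := qmin _ (cone_lowering_sublinear subq coneC C_le)
    (cone_lowering_le subq coneC C_le).
  have Cy : C (y, q y) by exists 1; rewrite ?scale1r ?mul1r.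
  have := cone_lowering_opp subq C_le Cy; rewrite eq_q /= => qNy.
  by have := sublinear_oppr_ge y subq; lra.
have qD x y : q (x + y) = q x + q y.
  apply/le_anti; rewrite subq.1 /=.
  by have := subq.1 (x + y) (- y); rewrite addrK qN; lra.
have qpos t x : 0 < t -> q (t *: x) = t * q x.
  move=> t0; apply/le_anti; rewrite subq.2//=.
  by have := subq.2 t (- x) t0; rewrite scalerN !qN; lra.
move=> t x y; rewrite qD; congr (_ + _).
have [t0|t0|->] := ltgtP t 0; last by rewrite scale0r mul0r sublinear0.
  by rewrite -[t]opprK scaleNr qN qpos ?oppr_gt0// -mulNr.
exact: qpos.
Qed.

(** The Mazur-Orlicz form of the Hahn-Banach theorem.  Extending a functional
    from a subspace is the case where the cone is its graph. *)
Theorem mazur_orlicz p C : sublinear p -> convex_cone C ->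
  (forall u, C u -> u.2 <= p u.1) ->
  exists f : {scalar V},
    (forall x, f x <= p x) /\ (forall u, C u -> u.2 <= f u.1).
Proof.
move=> subp coneC C_le.
have [f fmin fle] :=
  ex_minimal_sublinear (cone_lowering_sublinear subp coneC C_le).
pose F : {scalar V} := HB.pack f
  (GRing.isLinear.Build R V R *%R f (minimal_sublinear_linear fmin)).
exists F; split=> [x|u Cu] /=.
  exact: le_trans (fle x) (cone_lowering_le subp coneC C_le x).
have := le_trans (fle _) (cone_lowering_opp subp C_le Cu).
have := sublinear_oppr_ge u.1 fmin.1; lra.
Qed.

End MazurOrlicz.

(** * Functionals vanishing on a complex subspace that is not dense *)

Section HahnBanach.
Variable R : realType.

(** Restriction of scalars to R: a copy of V, so that its real vector space
    structure does not compete with the complex one. *)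
Definition realified (V : lmodType R[i]) : Type := V.

Section Realified.
Variable V : lmodType R[i].

Definition realified_scale (r : R) (x : realified V) : realified V :=
  (r%:C *: (x : V)).

HB.instance Definition _ := GRing.Zmodule.on (realified V).

Let scaleA a b (x : realified V) :
  realified_scale a (realified_scale b x) = realified_scale (a * b) x.
Proof. by rewrite /realified_scale scalerA -rmorphM. Qed.

Let scale1 : left_id 1 realified_scale.
Proof. by move=> x; rewrite /realified_scale rmorph1 scale1r. Qed.

Let scaleDr : right_distributive realified_scale +%R.
Proof. by move=> a x y; exact: scalerDr. Qed.

Let scaleDl (x : realified V) :
  {morph realified_scale^~ x : a b / a + b}.
Proof. by move=> a b; rewrite /realified_scale rmorphD; exact: scalerDl. Qed.

HB.instance Definition _ :=
  GRing.Zmodule_isLmodule.Build R (realified V) scaleA scale1 scaleDr scaleDl.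

Lemma realified_scaleE (r : R) (x : realified V) : r *: x = r%:C *: (x : V).
Proof. by []. Qed.

(** The unique complex linear functional with real part f, when f is real
    linear. *)
Definition complexification (f : V -> R) (x : V) : R[i]^o :=
  f x -i* f ('i *: x).

Lemma complexification_linear (f : {scalar realified V}) :
  linear (complexification f).
Proof.
have fZ r (x : V) : f (r%:C *: x) = r * f x by exact: (scalarZ f).
move=> [a b] x y.
have zE (z : V) : (a +i* b) *: z = a%:C *: z + b%:C *: ('i *: z).
  by rewrite scalerA -scalerDl; congr (_ *: _); simpc.
have iiN (z : V) : f ('i *: ('i *: z)) = - f z.
  by rewrite scalerA -expr2 sqr_i scaleN1r linearN.
rewrite /complexification scalerDr !(linearD f) zE (linearD f).
rewrite scalerDr (linearD f).
rewrite !scalerA !(mulrC 'i) -!scalerA !fZ iiN /GRing.scale/=.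
by apply/eqP; rewrite eq_complex /=; apply/andP; split; apply/eqP; ring.
Qed.

End Realified.

Variable V : normedModType R[i].

Let pnorm (x : realified V) : R := complex.Re `|x : V|.

Let pnormE (x : V) : (pnorm x)%:C = `|x|.
Proof. by rewrite RRe_real// normr_real. Qed.

Let pnorm_sublinear : sublinear pnorm.
Proof.
split=> [x y|t x t0]; rewrite -lecR ?rmorphD ?rmorphM /= !pnormE.
  exact: ler_normD.
by rewrite realified_scaleE normrZ gtr0_norm ?ltcR.
Qed.

(** The bound on f is one-sided, but f is odd, so |f x| <= |x|; the real and
    imaginary parts f x and - f (i x) then bound the complexification by
    2 |x|. *)
Lemma dominated_complexification_dual (f : {scalar realified V}) :
  (forall x, f x <= complex.Re `|x : V|) ->
  complexification f \in @dual_pred R V.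
Proof.
move=> fle; apply/asboolP; split; first exact: complexification_linear.
have lin := complexification_linear f.
pose F : {linear V -> R[i]^o} :=
  HB.pack (complexification f) (GRing.isLinear.Build _ _ _ _ _ lin).
have f_norm x : `|(f x)%:C| <= `|x : V|.
  rewrite -pnormE /pnorm normc_def /= expr0n addr0 sqrtr_sqr lecR ler_norml.
  by rewrite lerNl -linearN -{1}(normrN (x : V)) !fle.
apply: (@bounded_linear_continuous _ _ _ F); apply/linear_boundedP.
near=> r => x; apply: (@le_trans _ _ (2 * `|x|)).
  have -> : F x = (f x)%:C - 'i * (f ('i *: x))%:C.
    by rewrite /F /= /complexification; simpc.
  rewrite (le_trans (ler_normB _ _))// mulr_natl mulr2n lerD ?f_norm//.
  have i1 : `|'i : R[i]| = 1.
    by rewrite normc_def /= expr0n expr1n add0r sqrtr1.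
  by rewrite normrM i1 mul1r (le_trans (f_norm _))// normrZ i1 mul1r.
by rewrite ler_wpM2r//; near: r; apply: nbhs_pinfty_ge; rewrite realn.
Unshelve. all: by end_near. Qed.

Lemma dual_neq0 (F : dual V) : F != 0 -> exists x, F x != 0.
Proof.
move=> F0; apply/not_existsP => F_eq0; move/negP: F0; apply.
by apply/eqP/val_inj/funext => x /=; apply/eqP/negPn/negP/F_eq0.
Qed.

(** If the ball of radius e around x0 misses the subspace S, then the norm
    dominates the constraints f = 0 on S and f x0 >= e. *)
Theorem hahn_banach_not_dense (S : set V) :
  S 0 -> (forall k x y, S x -> S y -> S (k *: x + y)) -> ~ dense S ->
  exists2 F : dual V, F != 0 & forall x, S x -> F x = 0.
Proof.
move=> S0 Slin /existsNP[O /not_implyP[[x0 Ox0] /not_implyP[Oopen]]].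
move=> /nonemptyPn disj.
have SZ k x : S x -> S (k *: x).
  by move=> Sx; rewrite -[_ *: _]addr0; exact: Slin.
have SD x y : S x -> S y -> S (x + y).
  by move=> Sx Sy; rewrite -[x]scale1r; exact: Slin.
have [e e0 far] : exists2 e : R, 0 < e & forall s, S s -> e <= pnorm (x0 + s).
  have /nbhs_ballP[d /= d0 dO] : nbhs x0 O by exact: open_nbhs_nbhs.
  exists (complex.Re d) => [|s Ss].
    by rewrite -ltcR RRe_real// gtr0_real.
  rewrite leNgt -ltcR pnormE RRe_real ?gtr0_real//; apply/negP => near_s.
  have : (O `&` S) (- s).
    split; last by rewrite -scaleN1r; exact: SZ.
    by apply: dO; rewrite -ball_normE /ball_ /= opprK.
  by rewrite disj.
(* The cone generated by the constraints (s, 0) with s in S, and (x0, e). *)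
pose C := [set u : realified V * R |
  exists l s, [/\ 0 <= l, S s & u = (l%:C *: x0 + s, l * e)]].
have coneC : convex_cone C.
  split=> [|_ _ [l [s [l0 Ss ->]]] [k [t [k0 St ->]]]|r _ r0 [l [s [l0 Ss ->]]]].
  - by exists 0, 0; rewrite rmorph0 scale0r addr0 mul0r.
  - exists (l + k), (s + t); split; [exact: addr_ge0|exact: SD|].
    by rewrite /= addrACA rmorphD scalerDl mulrDl.
  - exists (r * l), (r%:C *: s); split; [exact/mulr_ge0/l0/ltW|exact: SZ|].
    by rewrite /= realified_scaleE scalerDr scalerA rmorphM mulrA.
have C_le u : C u -> u.2 <= pnorm u.1.
  move=> [l [s [+ Ss ->]]] /=; rewrite le_eqVlt => /orP[/eqP <-|l0].
    by rewrite mul0r -lecR pnormE rmorph0.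
  have lC0 : l%:C != 0 :> R[i] by rewrite gt_eqF ?ltcR.
  rewrite -[s](scalerKV lC0) -scalerDr -lecR pnormE normrZ rmorphM /=.
  rewrite gtr0_norm ?ltcR// ler_pM2l ?ltcR// -pnormE lecR; exact/far/SZ.
have [f [fle Cf]] := mazur_orlicz pnorm_sublinear coneC C_le.
pose F := Dual (dominated_complexification_dual fle).
(* The constraints 0 <= f s and 0 <= f (- s) force f to vanish on S. *)
have f_S s : S s -> f s = 0.
  have ge0 t : S t -> 0 <= f t.
    move=> St; apply: (Cf (t, 0)); exists 0, t; split=> //.
    by rewrite rmorph0 scale0r add0r mul0r.
  move=> Ss; apply/le_anti; rewrite ge0// andbT.
  by rewrite -oppr_ge0 -linearN ge0// -scaleN1r; exact: SZ.
exists F; last first.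
  by move=> s Ss; rewrite /= /complexification !f_S//; [simpc|exact: SZ].
have fx0 : e <= f x0.
  apply: (Cf (x0, e)); exists 1, 0; split=> //.
  by rewrite rmorph1 scale1r addr0 mul1r.
apply/eqP => /(congr1 (fun G : dual V => complex.Re (G x0))) /= fx00.
by move: fx0; rewrite fx00 leNgt e0.
Qed.

End HahnBanach.

(** * Weak amenability *)

Section WeakAmenability.
Variables (R : realType) (A : banachAlgType R[i]).

Lemma inner_cyclic (D : A -> dual A) : inner D -> cyclic D.
Proof.
move=> [F DE] a b; rewrite !DE /=.
rewrite -[LHS]/(F (a ** b) - F (b ** a) + (F (b ** a) - F (a ** b))).
by rewrite subrKA subrr.
Qed.

Lemma weakly_amenable_iff :
  weakly_amenable A <-> cyclically_amenable A /\ cyclically_weakly_amenable A.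
Proof.
split=> [wA|[cA cwA]]; last exact: etrans cwA cA.
have innC : @cont_inner_derivations R A `<=` @cont_cyclic_derivations R A.
  by move=> D [derD contD innD]; split=> //; exact: inner_cyclic.
have Cder : @cont_cyclic_derivations R A `<=` @cont_derivations R A.
  by move=> D [].
have der_cyclic : cyclically_weakly_amenable A.
  by apply/seteqP; split=> //; rewrite wA.
by split=> //; rewrite /cyclically_amenable -der_cyclic.
Qed.

(** The hypothesis is the Leibniz rule for the operator a |-> d a *: F.  Being
    inner, hence cyclic, this operator satisfies d a * F b = - (d b * F a);
    for a = b this gives d b = 0 as soon as F b != 0. *)
Lemma weakly_amenable_rank_one (d F : dual A) :
  weakly_amenable A ->
  (forall a b c, d (a ** b) * F c = d a * F (b ** c) + d b * F (c ** a)) ->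
  d = 0 \/ F = 0.
Proof.
move=> wA dF_der; have : cont_derivations (fun a => d a *: F).
  split; last by move=> a; apply: continuousZr_tmp; exact: dual_continuous.
  split=> [k a b|a b]; first by rewrite linearP scalerDl scalerA.
  by apply/val_inj/funext => c; exact: dF_der.
rewrite wA => -[_ _ /inner_cyclic dF_anti].
have anti a b : d a * F b = - (d b * F a).
  by apply/eqP; rewrite -addr_eq0; apply/eqP; exact: dF_anti.
have [->|F0] := eqVneq F 0; [by right|left].
have [b Fb] := dual_neq0 F0.
have db : d b = 0.
  have /eqP := anti b b; rewrite -addr_eq0 -mulr2n mulrn_eq0 mulf_eq0 (negPf Fb).
  by rewrite orbF => /eqP.
apply/val_inj/funext => a /=; apply/eqP; have /eqP := anti a b.
by rewrite db mul0r oppr0 mulf_eq0 (negPf Fb) orbF.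
Qed.

(** Where d a != 0, the Leibniz rule can be solved for phi, which shows that
    phi is linear and continuous. *)
Lemma point_derivation_dual (phi : A -> R[i]^o) (d : dual A) :
  point_derivation phi d -> d != 0 -> exists F : dual A, phi = F.
Proof.
move=> dphi /dual_neq0[a da].
exists ((d a)^-1 *: (dual_ract d a - phi a *: d)).
apply/funext => b.
rewrite -[RHS]/((d a)^-1 * (d (a ** b) - phi a * d b)) dphi addrK.
by rewrite mulKf.
Qed.

Lemma weakly_amenable_point_amenable : weakly_amenable A -> point_amenable A.
Proof.
move=> wA phi [_ phiM [a0 phia0]] d dphi; apply/eqP/negPn/negP => d0.
have [F phiE] := point_derivation_dual dphi d0; subst phi.
have [|d_eq0|F0] := @weakly_amenable_rank_one d F wA.
- move=> a b c; rewrite dphi !phiM; ring.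
- by rewrite d_eq0 eqxx in d0.
- by rewrite F0 eqxx in phia0.
Qed.

Lemma mem_square_span (a b : A) : square_span (a ** b).
Proof.
exists 1%N, (fun=> 1), (fun=> a), (fun=> b).
by rewrite big_ord1 scale1r.
Qed.

Lemma square_span_linear (k : R[i]) (x y : A) :
  square_span x -> square_span y -> square_span (k *: x + y).
Proof.
move=> [m [s [a [b ->]]]] [n [t [c [e ->]]]].
pose join T (u : 'I_m -> T) (v : 'I_n -> T) (i : 'I_(m + n)) :=
  match fintype.split i with inl j => u j | inr j => v j end.
exists (m + n)%N, (join _ (fun j => k * s j) t), (join _ a c), (join _ b e).
rewrite big_split_ord scaler_sumr; congr (_ + _); apply: eq_bigr => i _.
  by rewrite /join (unsplitK (inl i)) scalerA.
by rewrite /join (unsplitK (inr i)).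
Qed.

Lemma weakly_amenable_essential : weakly_amenable A -> essential A.
Proof.
move=> wA; apply: contrapT => ndense.
have span0 : square_span (0 : A).
  by exists 0%N, (fun=> 0), (fun=> 0), (fun=> 0); rewrite big_ord0.
have [F F0 Fsq] := hahn_banach_not_dense span0 square_span_linear ndense.
have Fm a b : F (a ** b) = 0 by apply: Fsq; exact: mem_square_span.
have [|F_eq0|F_eq0] := @weakly_amenable_rank_one F F wA.
- by move=> a b c; rewrite !Fm mul0r !mulr0 addr0.
- by rewrite F_eq0 eqxx in F0.
- by rewrite F_eq0 eqxx in F0.
Qed.

End WeakAmenability.

Theorem theorem4p1 (R : realType) (A : banachAlgType R[i]) :
  (weakly_amenable A <->
     cyclically_amenable A /\ cyclically_weakly_amenable A) /\
  (weakly_amenable A -> point_amenable A /\ essential A).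
Proof.
split; first exact: weakly_amenable_iff.
move=> wA; split; first exact: weakly_amenable_point_amenable.
exact: weakly_amenable_essential.
Qed.
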